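(* Let $\mathcal{B}=\mathcal{B}(\mathcal{C})$ be a building set on a finite set $X$ with generating collection $\mathcal{C}$, and let $S$ be an inclusion-minimal element of $\mathcal{C}$. Then $$\chi(\mathcal{B},m)=\chi(\mathcal{B}\setminus S,m)-\chi(\mathcal{B}/S,m).$$
   Context: A building set on a finite set $X$ is a collection $\mathcal{B}$ of nonempty subsets of $X$ such that (B1) if $S,S'\in\mathcal{B}$ and $S\cap S'\neq\emptyset$ then $S\cup S'\in\mathcal{B}$, and (B2) $\{i\}\in\mathcal{B}$ for all $i\in X$. For a collection $\mathcal{C}$ of subsets of $X$, $\mathcal{B}(\mathcal{C})$ denotes the smallest building set on $X$ containing $\mathcal{C}$. The generating collection of $\mathcal{B}$ is the unique minimal collection $\mathcal{C}$ (of sets with at least two elements) with $\mathcal{B}=\mathcal{B}(\mathcal{C})$. A proper coloring of $\mathcal{B}$ is $f:X\to\mathbb{N}$ such that every $T\in\mathcal{B}$ with $|T|\ge2$ contains $i,j$ with $f(i)\ne f(j)$; the chromatic polynomial $\chi(\mathcal{B},m)$ is the polynomial in $m$ whose value at a positive integer $m$ is the number of proper colorings $f:X\to[m]$ (equivalently $\chi(\mathcal{B},m)=\sum_{\alpha\models |X|}\zeta_\alpha(\mathcal{B})\binom{m}{k(\alpha)}$, where $\zeta_\alpha(\mathcal{B})$ counts ordered decompositions $X=J_1\sqcup\dots\sqcup J_k$ into blocks of sizes $a_i$ with every $\mathcal{B}|_{J_i}=\{T\in\mathcal{B}:T\subset J_i\}$ consisting only of singletons, and $k(\alpha)$ is the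 number of parts). The deletion is $\mathcal{B}\setminus S=\mathcal{B}(\mathcal{C}\setminus\{S\})$, a building set on $X$. Let $X/S=(X\setminus S)\cup\{S\}$ (the set $S$ becomes one new point) and for $A\subset X$ put $A/S=A$ if $A\cap S=\emptyset$ and $A/S=(A\setminus S)\cup\{S\}$ otherwise. The contraction is $\mathcal{B}/S=\mathcal{B}(\{A/S: A\in\mathcal{C}\})$, a building set on $X/S$. *)

(* Defs.v *)
From mathcomp Require Import all_boot all_order all_algebra.

Set Implicit Arguments.
Unset Strict Implicit.
Unset Printing Implicit Defensive.

Import GRing.Theory Num.Theory.

Definition building_set (X : finType) (B : {set {set X}}) : bool :=
  [&& set0 \notin B,
      [forall S in B, forall S' in B,
         (S :&: S' != set0) ==> (S :|: S' \in B)]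
    & [forall i : X, [set i] \in B]].

(* The intersection ranges over a nonempty family exactly when [set0 \notin C];
   see [generated_building], [sub_generated] and [generated_min]. *)
Definition generated (X : finType) (C : {set {set X}}) : {set {set X}} :=
  \bigcap_(B : {set {set X}} | building_set B && (C \subset B)) B.

(* Such a [C] is unique: see [generating_collection_exists_unique]. *)
Definition generating_collection (X : finType) (B C : {set {set X}}) : bool :=
  minset [pred D : {set {set X}} |
            [forall T in D, 1 < #|T|] && (generated D == B)] C.

Definition proper_coloring (X : finType) (K : eqType) (B : {set {set X}})
    (f : X -> K) : bool :=
  [forall T in B, (1 < #|T|) ==> [exists i in T, exists j in T, f i != f j]].

Definition num_colorings (X : finType) (B : {set {set X}}) (m : nat) : nat :=
  #|[set f : {ffun X -> 'I_m} | proper_coloring B f]|.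

Section BuildingSets.

Variable X : finType.
Implicit Types (B C D : {set {set X}}) (S T : {set X}).

Lemma building_setP B :
  reflect [/\ set0 \notin B,
              forall S T, S \in B -> T \in B -> S :&: T != set0 -> S :|: T \in B
            & forall i : X, [set i] \in B]
          (building_set B).
Proof.
apply: (iffP and3P) => -[B0 B1 B2]; split=> //.
- move=> S T SB TB ST.
  by have /forall_inP/(_ T TB)/implyP := forall_inP B1 S SB; apply.
- exact/forallP.
- apply/forall_inP => S SB; apply/forall_inP => T TB; apply/implyP; exact: B1.
- exact/forallP.
Qed.

Lemma sub_generated C : C \subset generated C.
Proof. by apply/bigcapsP => B /andP[]. Qed.

Lemma generated_min C B : building_set B -> C \subset B -> generated C \subset B.
Proof. by move=> hB CB; apply: bigcap_inf; rewrite hB. Qed.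

Lemma generated_building C : set0 \notin C -> building_set (generated C).
Proof.
move=> C0; apply/building_setP; split=> [|S T /bigcapP SG /bigcapP TG ST|i].
- pose D : {set {set X}} := [set T | T != set0].
  have hD : building_set D.
    apply/building_setP; split=> [|S T|i]; rewrite ?inE ?eqxx //.
    - by rewrite setU_eq0 => /negPf->.
    - by apply/set0Pn; exists i; rewrite inE.
  apply: contraL (generated_min (C := C) hD _) => [G0|].
    by apply/subsetPn; exists set0; rewrite // inE eqxx.
  by apply/subsetP => T TC; rewrite inE; apply: contraNneq C0 => <-.
- apply/bigcapP => B hB; case/andP: (hB) => /building_setP[_ + _] _.
  by apply=> //; [exact: SG | exact: TG].
- by apply/bigcapP => B /andP[/building_setP[_ _ ]].
Qed.

Lemma generated_sub C D : C \subset D -> set0 \notin D ->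
  generated C \subset generated D.
Proof.
move=> CD D0; apply: generated_min; first exact: generated_building.
exact: subset_trans CD (sub_generated D).
Qed.

Lemma generating_collection_exists_unique B : building_set B ->
  exists! C, generating_collection B C.
Proof.
move=> hB; have /building_setP[B0 BU B1] := hB.
pose P := [pred D : {set {set X}} |
            [forall T in D, 1 < #|T|] && (generated D == B)].
have no0 D : [forall T in D, 1 < #|T|] -> set0 \notin D.
  by move=> /forall_inP h; apply/negP => /h; rewrite cards0.
have delB0 S : set0 \notin B :\ S by rewrite inE negb_and B0 orbT.
pose I := [set S in B | (1 < #|S|) && (S \notin generated (B :\ S))].
have Ibig : [forall T in I, 1 < #|T|].
  by apply/forall_inP => T; rewrite inE => /and3P[].
have hG := generated_building (no0 _ Ibig).
have I_min D : P D -> I \subset D.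
  move=> /andP[Dbig /eqP DB]; apply/subsetP => S; rewrite inE.
  move=> /and3P[SB _]; apply: contraNT => SD.
  rewrite -{1}DB in SB; apply: subsetP SB; apply: generated_sub (delB0 S).
  apply/subsetP => T TD; rewrite !inE -{1}DB (subsetP (sub_generated D)) //.
  by rewrite andbT; apply: contraNneq SD => <-.
have PI : P I.
  rewrite /= Ibig eqEsubset generated_min //=; last first.
    by apply/subsetP => S; rewrite inE => /andP[].
  apply/subsetP => S; have [n] := ubnP #|S|; elim: n S => // n IHn S ltSn SB.
  have [_ GU G1] := building_setP _ hG.
  have [S1|Sbig] := leqP #|S| 1.
    have: #|S| == 1 by rewrite eqn_leq S1 card_gt0; apply: contraNneq B0 => <-.
    by case/cards1P => i ->.
  have [|SI] := boolP (S \in I); first exact/subsetP/sub_generated.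
  move: SI; rewrite inE SB Sbig /= negbK; apply: contraTT => SG.
  have hBS : building_set (B :\ S).
    apply/building_setP; split=> [//|T T'|i].
    - rewrite !inE => /andP[TS TB] /andP[TS' TB'] TT'.
      rewrite BU // andbT; apply: contraNneq SG => defS; rewrite -defS.
      have sub U : U \in B -> U != S -> U \subset T :|: T' -> U \in generated I.
        move=> UB US; rewrite defS => sUS; apply: IHn => //.
        have ltUS : U \proper S by rewrite properEneq US.
        exact: leq_trans (proper_card ltUS) _.
      by apply: GU => //; apply: sub; rewrite ?subsetUl ?subsetUr.
    - by rewrite !inE B1 andbT; apply: contraTneq Sbig => <-; rewrite cards1.
  apply/negP => /(subsetP (generated_min hBS (subxx _))).
  by rewrite !inE eqxx.
exists I; split=> [|D].
  by apply/minsetP; split=> // D /I_min ID DI; apply/eqP; rewrite eqEsubset DI.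
by case/minsetP => /I_min ID Dmin; exact: Dmin.
Qed.

End BuildingSets.

Local Open Scope ring_scope.

Section ChromaticPolynomial.

Variables (X : finType) (B : {set {set X}}).

Let surj_colorings k : {set {ffun X -> 'I_k}} :=
  [set f : {ffun X -> 'I_k} | proper_coloring B f & f @: [set: X] == setT].

Let surj_colorings_gt k : (#|X| < k)%N -> #|surj_colorings k| = 0%N.
Proof.
move=> ltXk; apply/eqP; rewrite cards_eq0 -subset0; apply/subsetP => f.
rewrite inE => /andP[_ /eqP fX]; move: (leq_imset_card f [set: X]).
by rewrite fX !cardsT card_ord leqNgt ltXk.
Qed.

Let card_image_colorings m (A : {set 'I_m}) :
  #|[set f : {ffun X -> 'I_m} | proper_coloring B f & f @: [set: X] == A]|
    = #|surj_colorings #|A| |.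
Proof.
pose h (g : {ffun X -> 'I_#|A|}) : {ffun X -> 'I_m} := [ffun x => enum_val (g x)].
have h_inj : injective h.
  move=> g g' /ffunP e; apply/ffunP => x; move: (e x); rewrite !ffunE.
  exact: enum_val_inj.
have h_proper g : proper_coloring B (h g) = proper_coloring B g.
  apply: eq_forallb => T; congr (_ ==> (_ ==> _)).
  apply: eq_existsb => i; congr (_ && _); apply: eq_existsb => j.
  by rewrite !ffunE (inj_eq enum_val_inj).
have h_im g : (h g @: [set: X] == A) = (g @: [set: X] == setT).
  have -> : h g @: [set: X] = enum_val @: (g @: [set: X]).
    by rewrite -imset_comp; apply: eq_imset => x; rewrite ffunE.
  have AE : enum_val @: [set: 'I_#|A|] = A.
    apply/setP => a; apply/imsetP/idP => [[i _ ->]|aA]; first exact: enum_valP.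
    by exists (enum_rank_in aA a); rewrite ?enum_rankK_in.
  rewrite -[X in _ == X]AE; apply/eqP/eqP => [|->//].
  exact: imset_inj (@enum_val_inj _ _) _ _.
rewrite -(card_imset _ h_inj); apply: eq_card => f; rewrite inE.
apply/idP/imsetP => [/andP[fB fA]|[g + ->]]; last by rewrite inE h_proper h_im.
have fxA x : f x \in A by rewrite -(eqP fA) imset_f.
pose g := [ffun x => enum_rank_in (fxA x) (f x)].
have fE : f = h g by apply/ffunP => x; rewrite !ffunE enum_rankK_in.
by exists g; rewrite // inE -h_proper -h_im -fE fB.
Qed.

Let num_coloringsE m :
  num_colorings B m = (\sum_(k < #|X|.+1) #|surj_colorings k| * 'C(m, k))%N.
Proof.
rewrite /num_colorings -sum1_card.
rewrite (partition_big (fun f : {ffun X -> 'I_m} => f @: [set: X]) predT) //=.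
transitivity (\sum_(A : {set 'I_m}) #|surj_colorings #|A| |)%N.
  apply: eq_bigr => A _; rewrite -card_image_colorings -sum1_card.
  by apply: eq_bigl => f; rewrite !inE.
rewrite (bigID (fun A : {set 'I_m} => #|A| < #|X|.+1)%N) /= addnC big1 ?add0n.
  rewrite (partition_big (fun A : {set 'I_m} => inord #|A| : 'I_#|X|.+1)
                         predT) //=.
  apply: eq_bigr => k _.
  have e (A : {set 'I_m}) :
      ((#|A| < #|X|.+1)%N && (inord #|A| == k)) = (#|A| == k :> nat).
    apply/andP/eqP => [[ltA /eqP <-]|->]; first by rewrite inordK.
    by rewrite ltn_ord inord_val.
  rewrite (eq_bigl _ _ e) (eq_bigr (fun=> #|surj_colorings k|)); last first.
    by move=> A /eqP ->.
  rewrite sum_nat_const mulnC; congr (_ * _)%N.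
  rewrite -[m in RHS](card_ord m) -(cardsT 'I_m) -cards_draws.
  by apply: eq_card => A; rewrite [in RHS]inE subsetT.
by move=> A; rewrite -leqNgt => /surj_colorings_gt.
Qed.

Lemma chromatic_poly_spec :
  {p : {poly rat} |
     forall m, (0 < m)%N -> p.[m%:R] = (num_colorings B m)%:R}.
Proof.
pose b k : {poly rat} := (k`!%:R)^-1 *: \prod_(i < k) ('X - i%:R%:P).
have bE k m : (b k).[m%:R] = ('C(m, k))%:R.
  have fk : k`!%:R != 0 :> rat by rewrite pnatr_eq0 -lt0n fact_gt0.
  apply: (mulfI fk); rewrite hornerZ mulVKf // -natrM mulnC bin_ffact.
  rewrite horner_prod ffact_prod natr_prod.
  have [lekm|ltmk] := leqP k m.
    apply: eq_bigr => i _; rewrite !hornerE natrB //.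
    by rewrite (leq_trans _ lekm) // ltnW.
  rewrite (bigD1 (Ordinal ltmk)) //= [RHS](bigD1 (Ordinal ltmk)) //=.
  by rewrite !hornerE subrr subnn !mul0r.
exists (\sum_(k < #|X|.+1) #|surj_colorings k|%:R *: b k) => m _.
rewrite horner_sum num_coloringsE natr_sum; apply: eq_bigr => k _.
by rewrite hornerZ bE natrM.
Qed.

End ChromaticPolynomial.

Definition chromatic_poly (X : finType) (B : {set {set X}}) : {poly rat} :=
  sval (chromatic_poly_spec B).

Lemma chromatic_poly_unique (X : finType) (B : {set {set X}}) (p : {poly rat}) :
  (forall m, (0 < m)%N -> p.[m%:R] = (num_colorings B m)%:R) ->
  p = chromatic_poly B.
Proof.
move=> pE; apply/eqP; rewrite -subr_eq0; apply/eqP.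
set q := p - _; pose s : seq rat := [seq i.+1%:R | i <- iota 0 (size q)].
apply: (roots_geq_poly_eq0 (rs := s)).
- apply/allP => _ /mapP[i _ ->]; apply/rootP.
  by rewrite hornerD hornerN pE // (svalP (chromatic_poly_spec B)) // subrr.
- rewrite map_inj_uniq ?iota_uniq // => i j /eqP.
  by rewrite eqr_nat => /eqP[].
- by rewrite size_map size_iota.
Qed.

(* The generating collection [C] is an explicit argument of both the deletion
   and the contraction. *)
Definition deletion (X : finType) (C : {set {set X}}) (S : {set X}) :
    {set {set X}} :=
  generated (C :\ S).

(* X/S: [Some x] is a point [x] outside [S], and [None] is the new point. *)
Definition quotient_points (X : finType) (S : {set X}) : finType :=
  option {x : X | x \notin S}.

Definition quotient_set (X : finType) (S A : {set X}) :
    {set quotient_points S} :=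
  [set y : quotient_points S |
     if y is Some x then val x \in A else ~~ [disjoint A & S]].

Definition contraction (X : finType) (C : {set {set X}}) (S : {set X}) :
    {set {set quotient_points S}} :=
  generated [set quotient_set S A | A in C].

(* Main.v *)
Require Import Defs.
From mathcomp Require Import all_boot all_order all_algebra.

Set Implicit Arguments.
Unset Strict Implicit.
Unset Printing Implicit Defensive.

(** A coloring is proper for the building set generated by [C] as soon as it is
    proper for [C], because the sets that are singletons or not monochromatic
    form a building set. Hence the proper colorings of the deletion split into
    those for which [S] is not monochromatic, which are the proper colorings of
    [B], and those that are constant on [S], which are the colorings that factor
    through [X -> X/S]. By minimality of [S] no other member of [C] collapses to
    a point of [X/S], so the factored colorings are exactly the proper colorings
    of the contraction. *)

Lemma proper_coloringP (X K : finType) (B : {set {set X}}) (f : X -> K) :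
  reflect {in B, forall T : {set X}, 1 < #|T| -> 1 < #|f @: T|} (proper_coloring B f).
Proof.
apply: (iffP forall_inP) => fB T TB.
  move=> T1; have /exists_inP[i iT /exists_inP[j jT fij]] :=
    implyP (fB T TB) T1.
  by apply/card_gt1P; exists (f i), (f j); rewrite !imset_f.
apply/implyP => /(fB T TB) /card_gt1P[_ [_ [/imsetP[i iT ->] /imsetP[j jT ->]]]].
by move=> fij; apply/exists_inP; exists i => //; apply/exists_inP; exists j.
Qed.

Lemma proper_coloring_generated (X K : finType) (C : {set {set X}})
    (f : X -> K) :
  set0 \notin C -> proper_coloring (generated C) f = proper_coloring C f.
Proof.
move=> C0; apply/proper_coloringP/proper_coloringP => fC T.
  by move=> TC; apply: fC; apply: subsetP TC; apply: sub_generated.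
pose D := [set U : {set X} | (U != set0) && ((1 < #|U|) ==> (1 < #|f @: U|))].
suff hD : building_set D.
  have CD : C \subset D.
    apply/subsetP => U UC; rewrite inE; apply/andP; split.
      by apply: contraNneq C0 => <-.
    by apply/implyP; apply: fC.
  by move=> /(subsetP (generated_min hD CD)); rewrite inE => /andP[_ /implyP].
apply/building_setP; split=> [|U V|i]; rewrite !inE ?eqxx //; last first.
  by rewrite cards1 andbT; apply/set0Pn; exists i; rewrite inE.
move=> /andP[U0 fU] /andP[V0 fV] /set0Pn[x /setIP[xU xV]].
rewrite setU_eq0 (negPf U0) /= imsetU.
(* Two colors on [U] survive in the union; otherwise [U] is just the common point [x], and the union
   is [V]. *)
have [U1|U1] := ltnP 1 #|U|.
  apply/implyP => _; apply: leq_trans (implyP fU U1) _.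
  exact/subset_leq_card/subsetUl.
have -> : U = [set x].
  by apply/esym/eqP; rewrite eqEcard sub1set xU cards1.
have xVs : [set x] \subset V by rewrite sub1set.
by rewrite (setUidPr xVs) (setUidPr (imsetS f xVs)).
Qed.

Section Quotient.

Variables (X : finType) (S : {set X}).

(** The projection from [X] to X/S: [insub] fails exactly on [S], and its default [None] is the new
    point. *)
Definition quotient_map (x : X) : quotient_points S := insub x.

Lemma quotient_map_eqNone x : (quotient_map x == None) = (x \in S).
Proof. by rewrite /quotient_map; case: insubP => [u /negPf->|/negPn->]. Qed.

Lemma quotient_map_val (u : {x : X | x \notin S}) :
  quotient_map (val u) = Some u.
Proof. exact: valK. Qed.

(** This makes the colors of A/S under [g] the colors of [A] under [g \o quotient_map]. *)
Lemma quotient_set_imset (A : {set X}) : quotient_set S A = quotient_map @: A.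
Proof.
apply/setP => -[u|]; rewrite inE.
  apply/idP/imsetP => [uA|[x xA]].
    by exists (val u); rewrite ?quotient_map_val.
  by rewrite /quotient_map; case: insubP => // v _ vx [->]; rewrite vx.
apply/pred0Pn/imsetP => [[x /andP[xA xS]]|[x xA /esym/eqP]].
  by exists x => //; apply/esym/eqP; rewrite quotient_map_eqNone.
by rewrite quotient_map_eqNone => xS; exists x; apply/andP.
Qed.

(** A point outside [S] is alone in its fibre, so any other point of [A] has a different image. *)
Lemma card_quotient_map_imset (A : {set X}) :
  1 < #|A| -> ~~ (A \subset S) -> 1 < #|quotient_map @: A|.
Proof.
move=> A1 /subsetPn[x xA xS]; have [y yA yx] : exists2 y, y \in A & y != x.
  have: 0 < #|A :\ x| by rewrite (cardsD1 x A) xA in A1.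
  by case/card_gt0P => y; rewrite !inE => /andP[yx yA]; exists y.
apply/card_gt1P; exists (quotient_map x), (quotient_map y).
split; rewrite ?imset_f //; apply: contraNneq yx.
move: (quotient_map_val (exist _ x xS)) => /= ->.
by rewrite /quotient_map; case: insubP => // v _ <- [<-].
Qed.

Lemma quotient_map_factor (K : Type) (f : X -> K) :
  S != set0 -> {in S &, forall x y, f x = f y} ->
  exists g : quotient_points S -> K, f =1 g \o quotient_map.
Proof.
case/set0Pn => s sS fS.
(* The new point receives the common color of [S], read off at [s]. *)
exists (fun y => if y is Some u then f (val u) else f s) => x /=.
by rewrite /quotient_map; case: insubP => [u _ ->|/negPn xS] //; apply: fS.
Qed.

Lemma quotient_map_surj (y : quotient_points S) :
  S != set0 -> exists x, quotient_map x = y.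
Proof.
case: y => [u _|/set0Pn[s sS]].
  by exists (val u); rewrite quotient_map_val.
by exists s; apply/eqP; rewrite quotient_map_eqNone.
Qed.

End Quotient.

(** The image of [S] is a single point and constrains nothing. Any other [A] in [C] is not inside
    [S], so A/S keeps two points and imposes on [g] the condition that [A] imposes on the
    pullback. *)
Lemma proper_coloring_contraction (X K : finType) (C : {set {set X}})
    (S : {set X}) (g : quotient_points S -> K) :
    {in C, forall A : {set X}, 1 < #|A|} ->
    {in C, forall A : {set X}, A \subset S -> A = S} ->
  proper_coloring (contraction C S) g =
    proper_coloring (C :\ S) (g \o quotient_map S).
Proof.
move=> C1 Cmin; rewrite proper_coloring_generated; last first.
  apply/imsetP => -[A /C1 A1 /esym/eqP].
  by rewrite quotient_set_imset imset_eq0 => /eqP A0; rewrite A0 cards0 in A1.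
apply/proper_coloringP/proper_coloringP => gC A.
  case/setD1P => AS AC A1; rewrite imset_comp -quotient_set_imset.
  apply: gC; first exact: imset_f.
  rewrite quotient_set_imset card_quotient_map_imset //.
  by apply: contraNN AS => /(Cmin A AC)->.
case/imsetP => {}A AC ->; rewrite quotient_set_imset => A1.
rewrite -imset_comp; apply: gC (C1 A AC); rewrite !inE AC andbT.
apply: contraTneq A1 => ->; rewrite -leqNgt -(cards1 (None : quotient_points S)).
apply/subset_leq_card/subsetP => _ /imsetP[x xS ->].
by rewrite inE quotient_map_eqNone.
Qed.

Lemma num_colorings_deletion (X : finType) (C : {set {set X}}) (S : {set X})
    (m : nat) :
    S \in C -> {in C, forall A : {set X}, 1 < #|A|} ->
    {in C, forall A : {set X}, A \subset S -> A = S} ->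
  num_colorings (deletion C S) m =
    num_colorings (generated C) m + num_colorings (contraction C S) m.
Proof.
move=> SC C1 Cmin.
have C0 : set0 \notin C by apply/negP => /C1; rewrite cards0.
have CS0 : set0 \notin C :\ S by rewrite inE negb_and C0 orbT.
have S0 : S != set0 by apply: contraNneq C0 => <-.
rewrite {1}/num_colorings.
rewrite -(cardsID [set f : {ffun X -> 'I_m} | 1 < #|f @: S|]).
congr (_ + _); rewrite /num_colorings.
  (* First summand: the condition at [S] is the one that separates [C] from [C :\ S]. *)
  apply: eq_card => f; rewrite !inE !proper_coloring_generated //.
  apply/andP/proper_coloringP => [[/proper_coloringP fC fS] T TC|fC].
    by have [->//|TS] := eqVneq T S; apply: fC; rewrite !inE TS.
  split; last exact: fC (C1 S SC).
  by apply/proper_coloringP => T /setD1P[_]; apply: fC.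
(* Second summand: pullback along the projection, injective because the projection is onto, has as
   image the colorings constant on [S]. *)
pose h (g : {ffun quotient_points S -> 'I_m}) : {ffun X -> 'I_m} :=
  [ffun x => g (quotient_map S x)].
have h_inj : injective h.
  move=> g g' /ffunP hgg'; apply/ffunP => y.
  by have [x <-] := quotient_map_surj y S0; have := hgg' x; rewrite !ffunE.
have hE g (A : {set X}) : h g @: A = (g \o quotient_map S) @: A.
  by apply: eq_imset => x; rewrite ffunE.
have h_proper g : proper_coloring (C :\ S) (h g) =
    proper_coloring (contraction C S) g.
  rewrite proper_coloring_contraction //.
  by apply/proper_coloringP/proper_coloringP => gC A; have := gC A; rewrite hE.
rewrite -(card_imset _ h_inj); apply: eq_card => f; rewrite !inE.
rewrite proper_coloring_generated //.
apply/andP/imsetP => [[fS fC]|[g + ->]]; last first.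
  rewrite inE h_proper => ->; split=> //; apply/card_gt1P.
  case=> _ [_ [/imsetP[x xS ->] /imsetP[y yS ->] /eqP[]]]; rewrite !ffunE.
  by congr (g _); transitivity (None : quotient_points S);
    [|apply/esym]; apply/eqP; rewrite quotient_map_eqNone.
have [x y xS yS|g fg] := @quotient_map_factor X S _ f S0.
  apply: contraNeq fS => fxy; apply/card_gt1P.
  by exists (f x), (f y); rewrite !imset_f.
have fE : f = h (finfun g) by apply/ffunP => x; rewrite !ffunE fg.
by exists (finfun g); rewrite // inE -h_proper -fE.
Qed.

Local Open Scope ring_scope.

Theorem theorem3 (X : finType) (B C : {set {set X}}) (S : {set X})
    (hB : building_set B) (hC : generating_collection B C)
    (hS : minset (mem C) S) :
  chromatic_poly B =
    chromatic_poly (deletion C S) - chromatic_poly (contraction C S).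
Proof.
have /minsetP[/andP[/forall_inP C1 /eqP <-] _] := hC.
have /minsetP[SC Smin] := hS.
(* The chromatic polynomial is determined by its values at positive integers, so counting colorings
   for each [m] suffices. *)
apply/esym/chromatic_poly_unique => m m0; rewrite hornerD hornerN.
rewrite !(svalP (chromatic_poly_spec _)) // num_colorings_deletion //.
by rewrite GRing.natrD GRing.addrK.
Qed.
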